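(* Let $S$ be an arbitrary (not necessarily finite) semigroup with zero $0$. Then the radical $R(S)$ is a two-sided ideal of $S$.
   Context: $S^1$ is $S$ with an identity adjoined if $S$ has none; $(x)=S^1xS^1$. A subsemigroup $T$ of $S$ is nilpotent if $T^m=\{0\}$ for some $m\in\mathbb{N}$. The radical is $R(S)=\{x\in S:(x)\text{ is a nilpotent semigroup}\}$. *)

(* Defs.v *)
From HB Require Import structures.
From mathcomp Require Import all_boot.
From mathcomp Require Import boolp classical_sets.

Set Implicit Arguments.
Unset Strict Implicit.
Unset Printing Implicit Defensive.

Local Open Scope classical_set_scope.
Local Open Scope group_scope.

Definition is_zero (S : semigroupType) (z : S) : Prop :=
  left_zero z (@mul S) /\ right_zero z (@mul S).

Definition is_identity (S : semigroupType) (e : S) : Prop :=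
  left_id e (@mul S) /\ right_id e (@mul S).

Definition setmul (S : semigroupType) (A B : set S) : set S :=
  [set x * y | x in A & y in B].

(* A * (A * (... * A)) with m factors; only meaningful for 0 < m. *)
Definition setpow (S : semigroupType) (A : set S) (m : nat) : set S :=
  iter m.-1 (setmul A) A.

Definition subsemigroup (S : semigroupType) (T : set S) : Prop :=
  T !=set0 /\ setmul T T `<=` T.

Definition nilpotent_subsemigroup (S : semigroupType) (z : S) (T : set S) :
    Prop :=
  subsemigroup T /\ exists2 m : nat, (0 < m)%N & setpow T m = [set z].

Definition two_sided_ideal (S : semigroupType) (I : set S) : Prop :=
  [/\ I !=set0, setmul [set: S] I `<=` I & setmul I [set: S] `<=` I].

(* S with a new identity None, adjoined unconditionally. *)
Definition adjoin (S : Type) : Type := option S.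

Section Adjoin.
Variable S : semigroupType.

Definition adjoin_mul (a b : adjoin S) : adjoin S :=
  match a, b with
  | Some x, Some y => Some (x * y)
  | None, _ => b
  | _, None => a
  end.

Lemma adjoin_mulA : associative adjoin_mul.
Proof. by move=> [x|] [y|] [w|] //=; rewrite mulgA. Qed.

HB.instance Definition _ := Choice.copy (adjoin S) (option S).
HB.instance Definition _ := isSemigroup.Build (adjoin S) adjoin_mulA.

End Adjoin.

Definition adj (S : Type) (x : S) : adjoin S := Some x.

(* S^1, as a subsemigroup of adjoin S: the new identity is kept only when S
   has no identity of its own, so otherwise S^1 is the copy adj @` S of S. *)
Definition S1 (S : semigroupType) : set (adjoin S) :=
  [set a | (exists x : S, a = adj x) \/
           (a = None /\ ~ exists e : S, is_identity e)].
Arguments S1 S : clear implicits.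

(* (x) = S^1 x S^1, computed in S^1 and read back in S. *)
Definition principal_ideal (S : semigroupType) (x : S) : set S :=
  @adj S @^-1` setmul (setmul (S1 S) [set adj x]) (S1 S).

Definition radical (S : semigroupType) (z : S) : set S :=
  [set x | nilpotent_subsemigroup z (principal_ideal x)].

(* Main.v *)
Require Import Defs.
From mathcomp Require Import all_boot.
From mathcomp Require Import classical_sets.

(* The ideal (z) is {z}, and both (u x) and (x u) are contained in (x).
   Every principal ideal is a subsemigroup containing z, so nilpotency of (x)
   passes to any smaller principal ideal. *)

Set Implicit Arguments.
Unset Strict Implicit.
Unset Printing Implicit Defensive.

Local Open Scope classical_set_scope.
Local Open Scope group_scope.

(** Nilpotency descends along inclusions of principal ideals, with the same exponent [m]: if (y)
    lies in (x) and (x)^m = {z}, then (y)^m lies in {z}, and it contains [z] because (y) does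
    ([radical_subset]). Closure of the radical under multiplication thus reduces to (ux) and (xu)
    lying in (x), by absorbing [u] into the left or right multiplier; non-emptiness comes from (z) =
    {z}. *)

Section PrincipalIdeals.
Variable S : semigroupType.
Implicit Types (x y u : S) (A B : set S).

Lemma S1_adj x : S1 S (adj x).
Proof. by left; exists x. Qed.

Lemma S1_mul (s t : adjoin S) : S1 S s -> S1 S t -> S1 S (s * t).
Proof.
(* If a factor is [None], the product is the other factor, already in [S1 S]. *)
by case: s t => [x|] [y|] // _ _; left; exists (x * y).
Qed.

Lemma principal_idealP x y :
  principal_ideal x y <->
  exists s t, [/\ S1 S s, S1 S t & adj y = s * adj x * t].
Proof.
split=> [[_ [s Ss [_ -> <-]] [t St eq_y]]|[s [t [Ss St eq_y]]]].
  by exists s, t.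
by exists (s * adj x); [exists s => //; exists (adj x)|exists t].
Qed.

Lemma principal_ideal_mull u x : principal_ideal (u * x) `<=` principal_ideal x.
Proof.
move=> y /principal_idealP [s [t [Ss St eq_y]]]; apply/principal_idealP.
exists (s * adj u), t; split=> //; first exact: S1_mul (S1_adj _).
by rewrite eq_y -(mulgA s (adj u)).
Qed.

Lemma principal_ideal_mulr x u : principal_ideal (x * u) `<=` principal_ideal x.
Proof.
move=> y /principal_idealP [s [t [Ss St eq_y]]]; apply/principal_idealP.
exists s, (adj u * t); split=> //; first exact: S1_mul (S1_adj _) St.
by rewrite eq_y mulgA -(mulgA s (adj x) (adj u)).
Qed.

Lemma principal_ideal_closed x :
  setmul (principal_ideal x) (principal_ideal x) `<=` principal_ideal x.
Proof.
move=> _ [a /principal_idealP [s [t [Ss St eq_a]]] [b _ <-]].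
(* (sxt)b = sx(tb): only the first factor need lie in the ideal. *)
apply/principal_idealP; exists s, (t * adj b); split=> //.
  exact: S1_mul (S1_adj _).
by rewrite mulgA -eq_a.
Qed.

Lemma setpow_subset A B m : A `<=` B -> setpow A m `<=` setpow B m.
Proof.
move=> sAB; rewrite /setpow; elim: m.-1 => //= n IHn _ [a Aa [b Ab <-]].
by exists a; [exact: sAB|exists b; [exact: IHn|]].
Qed.

Variables (z : S) (hz : is_zero z).

Lemma setpow_zero A m : A z -> setpow A m z.
Proof.
move=> Az; rewrite /setpow; elim: m.-1 => //= n IHn.
by exists z => //; exists z => //; exact: hz.1.
Qed.

Lemma principal_ideal_has_zero x : principal_ideal x z.
Proof.
(* The multipliers are taken to be [z], since [None] need not belong to [S1 S]. *)
apply/principal_idealP; exists (adj z), (adj z); split; try exact: S1_adj.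
by congr Some; rewrite !hz.1.
Qed.

Lemma principal_ideal_subsemigroup x : subsemigroup (principal_ideal x).
Proof.
split; last exact: principal_ideal_closed.
by exists z; exact: principal_ideal_has_zero.
Qed.

Lemma principal_ideal_zero : principal_ideal z = [set z].
Proof.
apply/seteqP; split=> [y|_ ->]; last exact: principal_ideal_has_zero.
case/principal_idealP=> -[s|] [[t|] [_ _ [->]]] //=.
- by rewrite hz.2 hz.1.
- exact: hz.2.
- exact: hz.1.
Qed.

Lemma radical_zero : radical z z.
Proof.
split; first exact: principal_ideal_subsemigroup.
by exists 1%N => //; exact: principal_ideal_zero.
Qed.

(** Monotonicity of powers bounds (y)^m above by {z}; membership of [z] in every principal ideal
    gives the reverse inclusion. *)
Lemma radical_subset x y :
  principal_ideal y `<=` principal_ideal x -> radical z x -> radical z y.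
Proof.
move=> syx [_ [m m_gt0 xm]]; split; first exact: principal_ideal_subsemigroup.
exists m => //; apply/seteqP; split; first by rewrite -xm; exact: setpow_subset.
by move=> _ ->; exact/setpow_zero/principal_ideal_has_zero.
Qed.

End PrincipalIdeals.

Theorem lemma3p1 (S : semigroupType) (z : S) (hz : is_zero z) :
  two_sided_ideal (radical z).
Proof.
split; first by exists z; exact: radical_zero.
  by move=> _ [u _ [x Rx <-]]; exact/(radical_subset hz _ Rx)/principal_ideal_mull.
by move=> _ [x Rx [u _ <-]]; exact/(radical_subset hz _ Rx)/principal_ideal_mulr.
Qed.
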